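(* Let $s<t$ be relatively prime positive integers, and use the convention $\overline{\{m\}}=\emptyset$ for integers $m\le 0$. Then: (i) for positive integers $i,j$, $\overline{\{i\}}-j=\overline{\{i-j\}}$; (ii) for positive integers $i,j$, $\overline{\overline{\{i\}}+j}=\overline{\{i+j\}}$; (iii) for a positive integer $i$, if $\{s,t\}\cap\overline{\{i\}}=\emptyset$ then $|\overline{\{i+1\}}|-|\overline{\{i\}}|=0$, and otherwise $|\overline{\{i+1\}}|-|\overline{\{i\}}|=1$; (iv) for every integer $n\ge0$ there is an integer $i\ge 0$ with $|\overline{\{i\}}|=n$; (v) for positive integers $a,b$: $a\le b$ if and only if $\overline{\{a\}}\prec\overline{\{b\}}$; (vi) for positive integers $a,b$: $|\overline{\{a\}}|<|\overline{\{b\}}|$ implies $a<b$.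
   Context: The $(s,t)$-closure of a set $\beta$ of integers is $\overline{\beta}=\{x-as-bt : x\in\beta,\ a,b\ge0 \text{ integers},\ x>as+bt\}$. For a finite set $\beta$ of positive integers and a positive integer $k$: $\beta+k=\{x+k:x\in\beta\}$ and $\beta-k=\{x-k:x\in\beta,\ x>k\}$. A beta-set is a finite set of positive integers written decreasingly $\beta=\{\beta_1>\dots>\beta_n\}$, with associated partition $P(\beta)=(\beta_1-(n-1),\dots,\beta_n)$. For partitions $P=(P_1,\dots,P_n)$, $Q=(Q_1,\dots,Q_m)$ write $P<Q$ if $n\le m$ and $P_i\le Q_i$ for $i\le n$; for beta-sets $\beta\prec\gamma$ means $P(\beta)<P(\gamma)$. *)

(* Defs.v *)
From mathcomp Require Import all_boot all_order all_algebra finmap.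
From mathcomp Require Import all_classical.

Set Implicit Arguments.
Unset Strict Implicit.
Unset Printing Implicit Defensive.

Import Order.TTheory GRing.Theory Num.Theory.
Local Open Scope classical_set_scope.
Local Open Scope ring_scope.

Definition st_closure (s t : int) (B : set int) : set int :=
  [set y | exists x a b : int,
    [/\ B x, 0 <= a, 0 <= b, a * s + b * t < x & y = x - a * s - b * t]].

Definition shift_up (B : set int) (k : int) : set int :=
  [set x + k | x in B].

Definition shift_down (B : set int) (k : int) : set int :=
  [set x - k | x in B `&` [set x | k < x]].

Definition is_beta_set (B : set int) : Prop :=
  finite_set B /\ forall x, B x -> 0 < x.

(* [fset_set B] is the empty finite set when [B] is infinite, so the next three
   definitions are meaningful for finite [B] only; [is_beta_set_closure1] below
   shows that this covers the closures of singletons. *)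
Definition card_set (B : set int) : nat := #|` fset_set B|.

Definition beta_seq (B : set int) : seq int :=
  sort (fun x y : int => y <= x) (fset_set B).

(* Indices start at 0: the i-th part is beta_(i+1) - (n - (i+1)). *)
Definition beta_partition (B : set int) : seq int :=
  let b := beta_seq B in
  mkseq (fun i => b`_i - (size b - i.+1)%N%:Z) (size b).

Definition partition_le (P Q : seq int) : Prop :=
  (size P <= size Q)%N /\ forall i, (i < size P)%N -> P`_i <= Q`_i.

Definition beta_prec (B C : set int) : Prop :=
  partition_le (beta_partition B) (beta_partition C).

(* The condition a * s + b * t < m is never met for m <= 0, so the convention
   that {m} then has empty closure needs no case distinction. *)
Lemma st_closure1_le0 (s t m : int) : 0 < s -> 0 < t -> m <= 0 ->
  st_closure s t [set m] = set0.
Proof.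
move=> s0 t0 m0; apply/seteqP; split=> // y [x [a [b [-> a0 b0 + _]]]].
rewrite ltNge; apply/negP/negPn; apply: (le_trans m0).
by rewrite addr_ge0 // mulr_ge0 // ltW.
Qed.

Lemma is_beta_set_closure1 (s t i : int) : 0 < s -> 0 < t ->
  is_beta_set (st_closure s t [set i]).
Proof.
move=> s0 t0.
have closure_bounds y : st_closure s t [set i] y -> 0 < y <= i.
  move=> [x [a [b [-> a0 b0 lt_i ->]]]].
  rewrite -addrA -opprD subr_gt0 lt_i gerBl.
  by rewrite addr_ge0 // mulr_ge0 // ltW.
split=> [|y /closure_bounds /andP[]//].
apply: (@sub_finite_set _ _ ((fun n : nat => n%:Z) @` `I_(`|i|%N.+1))); last first.
  exact/finite_image/finite_II.
move=> y /closure_bounds /andP[y0 yi]; exists `|y|%N; last by rewrite /= gtz0_abs.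
by rewrite /= ltnS -lez_nat !gtz0_abs // (lt_le_trans y0 yi).
Qed.

(* Main.v *)
(** Let [S] be the numerical semigroup generated by [s] and [t]. The closure
    of [{m}] is [{m - n : n in S, n < m}], so its cardinality is the counting
    function [N m = #(S `&` [0, m[)], which is nondecreasing and 1-Lipschitz.
    If [n_0 < n_1 < ...] enumerates [S], the i-th part of the partition of the
    closure of [{m}] is [(m - N m) - n_i + i + 1]; hence the order on
    partitions amounts to comparing both [N m] and [m - N m], and it only
    remains to use that these are nondecreasing in [m] with sum [m]. *)

Require Import Defs.
From mathcomp Require Import all_boot all_order all_algebra finmap.
From mathcomp Require Import all_classical.
From mathcomp Require Import zify ring.

Set Implicit Arguments.
Unset Strict Implicit.
Unset Printing Implicit Defensive.

Import Order.TTheory GRing.Theory Num.Theory.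
Local Open Scope classical_set_scope.
Local Open Scope ring_scope.

Definition semigroup2 (s t : int) : set int :=
  [set n | exists a b : int, [/\ 0 <= a, 0 <= b & n = a * s + b * t]].

Lemma semigroup2_0 s t : semigroup2 s t 0.
Proof. by exists 0, 0; rewrite !mul0r addr0. Qed.

Lemma semigroup2D s t m n :
  semigroup2 s t m -> semigroup2 s t n -> semigroup2 s t (m + n).
Proof.
move=> [a [b [a0 b0 ->]]] [c [d [c0 d0 ->]]].
by exists (a + c), (b + d); split; rewrite ?addr_ge0 //; ring.
Qed.

Lemma semigroup2_l s t : semigroup2 s t s.
Proof. by exists 1, 0; rewrite mul1r mul0r addr0. Qed.

Lemma semigroup2_r s t : semigroup2 s t t.
Proof. by exists 0, 1; rewrite mul1r mul0r add0r. Qed.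

Lemma semigroup2_ge0 s t n : 0 < s -> 0 < t -> semigroup2 s t n -> 0 <= n.
Proof. by move=> s0 t0 [a [b [a0 b0 ->]]]; rewrite addr_ge0 // mulr_ge0 // ltW. Qed.

(** A positive combination has a nonzero coefficient, so one copy of that generator can be
    removed. *)
Lemma semigroup2_descent s t n : 0 < n -> semigroup2 s t n ->
  semigroup2 s t (n - s) \/ semigroup2 s t (n - t).
Proof.
move=> n0 [a [b [a0 b0 nE]]].
have [a1|a1] := ltP 0 a.
  by left; exists (a - 1), b; split=> //; [lia|rewrite nE; ring].
have a_eq0 : a = 0 by lia.
have [b1|b1] := ltP 0 b.
  by right; exists a, (b - 1); split=> //; [lia|rewrite nE; ring].
have b_eq0 : b = 0 by lia.
by move: n0; rewrite nE a_eq0 b_eq0 !mul0r addr0 ltxx.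
Qed.

(** The strict bound on [a * s + b * t] is exactly positivity of [y]. What remains depends only on
    the difference [x - y]. *)
Lemma st_closureP s t B y :
  st_closure s t B y <-> exists x, [/\ B x, 0 < y & semigroup2 s t (x - y)].
Proof.
split=> [[x [a [b [Bx a0 b0 lt_x ->]]]]|[x [Bx y0 [a [b [a0 b0 xyE]]]]]].
  by exists x; split=> //; [lia|exists a, b; split=> //; ring].
by exists x, a, b; split=> //; lia.
Qed.

Lemma st_closure1P s t m y :
  st_closure s t [set m] y <-> 0 < y /\ semigroup2 s t (m - y).
Proof.
rewrite st_closureP; split=> [[x [-> //]]|[y0 Sy]].
by exists m.
Qed.

Lemma shift_down_closure1 s t i j : 0 < j ->
  shift_down (st_closure s t [set i]) j = st_closure s t [set i - j].
Proof.
move=> j0; apply/seteqP; split=> y.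
  move=> [x [/st_closure1P[x0 Sx] /= jx] <-]; apply/st_closure1P; split; first lia.
  by rewrite (_ : i - j - (x - j) = i - x) //; ring.
move=> /st_closure1P[y0 Sy]; exists (y + j); last by rewrite addrK.
split=> /=; last lia.
apply/st_closure1P; split; first lia.
by rewrite (_ : i - (y + j) = i - j - y) //; ring.
Qed.

(** Additivity of the semigroup collapses two successive descents into one. Conversely [i] lies in
    its own closure because 0 is in the semigroup, so [i + j] is a seed of the outer closure. *)
Lemma st_closure_shift_up1 s t i j : 0 < i ->
  st_closure s t (shift_up (st_closure s t [set i]) j) =
  st_closure s t [set i + j].
Proof.
move=> i0; apply/seteqP; split=> y.
  move=> /st_closureP[_ [[x /st_closure1P[x0 Sx] <-] y0 Sy]].
  apply/st_closure1P; split=> //.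
  by rewrite (_ : i + j - y = (i - x) + (x + j - y)); [exact: semigroup2D|ring].
move=> /st_closure1P[y0 Sy]; apply/st_closureP; exists (i + j); split=> //.
exists i => //; apply/st_closure1P; split=> //.
by rewrite subrr; exact: semigroup2_0.
Qed.

(** A generator lies in the closure when subtracting it from [i] stays in the semigroup. This turns
    the case distinction of (iii) into membership of [i]. *)
Lemma generators_closure1 s t i : 0 < s -> 0 < t -> 0 < i ->
  [set s; t] `&` st_closure s t [set i] !=set0 <-> semigroup2 s t i.
Proof.
move=> s0 t0 i0; split=> [[_ [[|] -> /st_closure1P[_ Si]]]|Si].
- by rewrite -(subrK s i); apply: semigroup2D => //; exact: semigroup2_l.
- by rewrite -(subrK t i); apply: semigroup2D => //; exact: semigroup2_r.
have [Sis|Sit] := semigroup2_descent i0 Si.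
  by exists s; split; [left|apply/st_closure1P].
by exists t; split; [right|apply/st_closure1P].
Qed.

Definition semigroup2_below (s t : int) (m : nat) : seq nat :=
  [seq n <- iota 0 m | `[< semigroup2 s t n%:Z >]].

Lemma semigroup2_belowS s t m : semigroup2_below s t m.+1 =
  semigroup2_below s t m ++ [seq n <- [:: m] | `[< semigroup2 s t n%:Z >]].
Proof. by rewrite /semigroup2_below -addn1 iotaD filter_cat. Qed.

(** Filtering a longer [iota] only appends entries, at most one per new integer. Monotonicity and
    the Lipschitz bound of the counting function both come from here. *)
Lemma semigroup2_belowD s t m k : exists2 r, (size r <= k)%N &
  semigroup2_below s t (m + k) = semigroup2_below s t m ++ r.
Proof.
exists [seq n <- iota m k | `[< semigroup2 s t n%:Z >]].
  by rewrite size_filter (leq_trans (count_size _ _)) // size_iota.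
by rewrite /semigroup2_below iotaD filter_cat.
Qed.

Lemma semigroup2_below_gt0 s t m : (0 < m)%N ->
  exists r, semigroup2_below s t m = 0%N :: r.
Proof.
case: m => // m _; rewrite /semigroup2_below /=.
by case: asboolP => [_|/(_ (semigroup2_0 _ _))//]; eexists.
Qed.

(** The reflection [n] to [m - n] turns the increasing enumeration of the semigroup into a
    decreasing one of the closure, and a sorted list is determined by its elements. *)
Lemma beta_seq_closure1 s t (m : nat) : 0 < s -> 0 < t ->
  beta_seq (st_closure s t [set m%:Z]) =
  [seq m%:Z - n%:Z | n <- semigroup2_below s t m].
Proof.
move=> s0 t0; apply: (@sorted_eq _ (fun x y : int => y <= x)).
- by move=> y x z yx zy; exact: le_trans zy yx.
- by move=> x y /andP[yx xy]; apply/le_anti; rewrite xy yx.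
- by apply: sort_sorted => x y; exact: le_total.
- rewrite sorted_map; apply: (@sub_sorted _ leq) => [x y /= xy|]; first lia.
  by apply: sorted_filter; [exact: leq_trans|exact: iota_sorted].
rewrite perm_sort; apply: uniq_perm => [||y].
- exact: fset_uniq.
- rewrite map_inj_uniq ?filter_uniq ?iota_uniq // => x y /=; lia.
have [finC _] := is_beta_set_closure1 m%:Z s0 t0.
rewrite in_fset_set //; apply/idP/mapP.
  rewrite inE => /st_closure1P[y0 Sy]; have := semigroup2_ge0 s0 t0 Sy => my0.
  exists `|m%:Z - y|%N; last by rewrite gez0_abs //; ring.
  rewrite mem_filter mem_iota; apply/andP; split; last lia.
  by apply/asboolP; rewrite gez0_abs.
move=> [n]; rewrite mem_filter mem_iota => /andP[/asboolP Sn nm] ->.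
rewrite inE; apply/st_closure1P; split; first lia.
by rewrite (_ : m%:Z - (m%:Z - n%:Z) = n%:Z) //; ring.
Qed.

Lemma card_closure1 s t (m : nat) : 0 < s -> 0 < t ->
  card_set (st_closure s t [set m%:Z]) = size (semigroup2_below s t m).
Proof.
move=> s0 t0; rewrite -(size_map (fun n : nat => m%:Z - n%:Z)).
by rewrite -beta_seq_closure1 // size_sort.
Qed.

Lemma card_closure1S s t (m : nat) : 0 < s -> 0 < t ->
  card_set (st_closure s t [set m.+1%:Z]) =
  (card_set (st_closure s t [set m%:Z]) + `[< semigroup2 s t m%:Z >])%N.
Proof.
move=> s0 t0; rewrite !card_closure1 // semigroup2_belowS size_cat /=.
by case: asboolP.
Qed.

Lemma card_closure1_le s t (a b : nat) : 0 < s -> 0 < t -> (a <= b)%N ->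
  (card_set (st_closure s t [set a%:Z]) <=
   card_set (st_closure s t [set b%:Z]))%N.
Proof.
move=> s0 t0 /subnKC <-; rewrite !card_closure1 //.
by have [r _ ->] := semigroup2_belowD s t a (b - a); rewrite size_cat leq_addr.
Qed.

Lemma card_closure1_surj s t n : 0 < s -> 0 < t ->
  exists m : nat, card_set (st_closure s t [set m%:Z]) = n.
Proof.
move=> s0 t0; elim: n => [|n [m <-]].
  by exists 0%N; rewrite card_closure1.
have S_unbounded : exists k, (m <= k)%N && `[< semigroup2 s t k%:Z >].
  (* A multiple of [s], at least [m] since [s] is a positive integer. *)
  exists (m * `|s|)%N; apply/andP; split; first nia.
  by apply/asboolP; exists m%:Z, 0; split=> //; lia.
(* With [k] the first semigroup element from [m] on, the count is constant from [m] to [k] and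
   increases by one at [k.+1]. *)
case: (ex_minnP S_unbounded) => k /andP[mk Sk] k_min.
exists k.+1; rewrite card_closure1S // Sk addn1; congr _.+1.
have {}k_min j : (m <= j < k)%N -> ~~ `[< semigroup2 s t j%:Z >].
  move=> /andP[mj jk]; apply/negP => Sj.
  by have := k_min j; rewrite mj Sj leqNgt jk => /(_ isT).
elim: k mk k_min {Sk} => [|k IHk]; first by rewrite leqn0 => /eqP ->.
rewrite leq_eqVlt => /predU1P[<- //|mk] k_min.
rewrite card_closure1S // (negbTE (k_min _ _)) ?addn0; last by rewrite -ltnS mk /=.
by apply: IHk => // j /andP[mj jk]; apply: k_min; rewrite mj ltnS ltnW.
Qed.

Lemma size_beta_partition B : size (beta_partition B) = card_set B.
Proof. by rewrite size_mkseq size_sort. Qed.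

Lemma beta_partition_closure1 s t (m : nat) i : 0 < s -> 0 < t ->
  (i < card_set (st_closure s t [set m%:Z]))%N ->
  (beta_partition (st_closure s t [set m%:Z]))`_i =
  (m%:Z - (card_set (st_closure s t [set m%:Z]))%:Z)
    - (nth 0%N (semigroup2_below s t m) i)%:Z + i.+1%:Z.
Proof.
move=> s0 t0 ltiN; rewrite nth_mkseq; last by rewrite size_sort.
rewrite beta_seq_closure1 // size_map -card_closure1 // (nth_map 0%N).
  (* The truncated subtraction in the definition is exact because [i] is less than the
     cardinality. *)
  by rewrite -subzn //; ring.
by rewrite -card_closure1.
Qed.

Lemma beta_prec_closure1 s t (a b : nat) : 0 < s -> 0 < t -> (0 < a)%N ->
  (a <= b)%N <->
  beta_prec (st_closure s t [set a%:Z]) (st_closure s t [set b%:Z]).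
Proof.
move=> s0 t0 a0; split=> [le_ab|].
  have leN := card_closure1_le s0 t0 le_ab.
  split; rewrite !size_beta_partition // => i ltiN.
  have ltiNb := leq_trans ltiN leN.
  rewrite !beta_partition_closure1 //.
  move: ltiN; rewrite !card_closure1 // -(subnKC le_ab).
  have [r le_r ->] := semigroup2_belowD s t a (b - a).
  (* Both lists have the same [i]-th entry, so the bound on [size r] suffices. *)
  by rewrite nth_cat size_cat => ltiN; rewrite ltiN; lia.
move=> [+ /(_ 0%N)]; rewrite !size_beta_partition => leN le0.
(* If [b < a], monotonicity and [leN] force equal cardinalities. The first parts, both with
   semigroup entry 0, then give [a <= b]. *)
rewrite leqNgt; apply/negP => lt_ba.
have geN := card_closure1_le s0 t0 (ltnW lt_ba).
have Na0 : (0 < card_set (st_closure s t [set a%:Z]))%N.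
  by rewrite card_closure1 //; have [r ->] := semigroup2_below_gt0 s t a0.
have Nb0 := leq_trans Na0 leN.
have b0 : (0 < b)%N.
  by case: b Nb0 {leN le0 lt_ba geN} => //; rewrite card_closure1.
move: (le0 Na0); rewrite !beta_partition_closure1 //.
have [ra ->] := semigroup2_below_gt0 s t a0.
have [rb ->] := semigroup2_below_gt0 s t b0.
rewrite /=; lia.
Qed.

Theorem theorem3p1 (s t : int) (s_gt0 : 0 < s) (lt_st : s < t)
    (co_st : coprimez s t) :
  (forall i j : int, 0 < i -> 0 < j ->
     shift_down (st_closure s t [set i]) j = st_closure s t [set i - j]) /\
  (forall i j : int, 0 < i -> 0 < j ->
     st_closure s t (shift_up (st_closure s t [set i]) j) =
     st_closure s t [set i + j]) /\
  (forall i : int, 0 < i ->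
     ([set s; t] `&` st_closure s t [set i] = set0 ->
        (card_set (st_closure s t [set i + 1]))%:Z
          - (card_set (st_closure s t [set i]))%:Z = 0) /\
     ([set s; t] `&` st_closure s t [set i] <> set0 ->
        (card_set (st_closure s t [set i + 1]))%:Z
          - (card_set (st_closure s t [set i]))%:Z = 1)) /\
  (forall n : nat, exists i : int,
     0 <= i /\ card_set (st_closure s t [set i]) = n) /\
  (forall a b : int, 0 < a -> 0 < b ->
     (a <= b <-> beta_prec (st_closure s t [set a]) (st_closure s t [set b]))) /\
  (forall a b : int, 0 < a -> 0 < b ->
     (card_set (st_closure s t [set a]) < card_set (st_closure s t [set b]))%N ->
     a < b).
Proof.
have t_gt0 : 0 < t by exact: lt_trans lt_st.
split; first by move=> i j _; exact: shift_down_closure1.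
split; first by move=> i j i0 _; exact: st_closure_shift_up1.
split.
  (* Positive integers are replaced by naturals, for which the counting lemmas are stated. *)
  case=> // i i0; rewrite -PoszD addn1 card_closure1S //; split.
    move=> /eqP noS; rewrite asboolF ?addn0 ?subrr // => Si.
    by move: noS; apply/negP/set0P/generators_closure1.
  move=> /eqP/set0P/(generators_closure1 s_gt0 t_gt0 i0) Si.
  by rewrite (asboolT Si) PoszD addrC addKr.
split.
  by move=> n; have [m cardm] := card_closure1_surj n s_gt0 t_gt0; exists m%:Z.
split; first by case=> // a; case=> // b a0 _; exact: beta_prec_closure1.
(* Contrapositive of the monotonicity of the counting function. *)
case=> // a; case=> // b _ _; rewrite ltnNge ltNge => /negP ltN.
by apply/negP => le_ba; exact/ltN/card_closure1_le.
Qed.
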